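(* Let $n$ be a positive integer and let $T_1,T_2$ be increasing tableaux of straight shape on $[n]=\{1,\dots,n\}$ with $T_1\equiv T_2$. Let $N=\frac{n(n+1)(n+2)}{3}+3$. Then $\mathrm{row}(T_1)\overset{N}{\equiv}\mathrm{row}(T_2)$.
   Context: A straight shape is the Young diagram of a partition, i.e. a finite $\lambda\subset\mathbb{N}\times\mathbb{N}$ ($\mathbb{N}$ the positive integers; $(i,j)$ is in row $i$, column $j$, rows numbered downward) containing with $(i,j)$ every $(i',j')$ with $i'\le i$, $j'\le j$. An increasing tableau of straight shape $\lambda$ is a map $T:\lambda\to\mathbb{N}$ strictly increasing left to right along rows and down columns. A tableau on $[n]$ is one all of whose labels lie in $[n]$. $\mathrm{row}(T)$ is the word obtained by reading the entries of $T$ left to right along each row, starting from the bottom row and moving upward. A $K$-Knuth move on a word in $\mathbb{N}$ is a replacement of consecutive letters, in either direction, according to one of: $xzy\equiv zxy$ $(x<y<z)$; $yxz\equiv yzx$ $(x<y<z)$; $x\equiv xx$; $xyx\equiv yxy$. Two words are $K$-Knuth equivalent ($w\equiv w'$) if they are connected by finitely many $K$-Knuth moves. For tableaux, $T\equiv T'$ means $\mathrm{row}(T)\equiv\mathrm{row}(T')$. For a positive integer $k$, $w\overset{k}{\equiv}w'$ means there is a sequence $w=w_0,w_1,\dots,w_r=w'$ of words such that $w_i$ and $w_{i+1}$ differ by one $K$-Knuth move for each $i$ and every $w_i$ has length at most $k$. *)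

(* Defs.v *)
From mathcomp Require Import all_boot.

Set Implicit Arguments.
Unset Strict Implicit.
Unset Printing Implicit Defensive.

(* Letters are natural numbers. A K-Knuth move does not change the set of
   letters occurring in a word, so starting from words in the positive integers
   the letter 0 never appears and no positivity condition is needed here. *)
Definition word := seq nat.

Inductive kknuth_rule : word -> word -> Prop :=
| KKnuth_xzy x y z : x < y -> y < z ->
    kknuth_rule [:: x; z; y] [:: z; x; y]
| KKnuth_yxz x y z : x < y -> y < z ->
    kknuth_rule [:: y; x; z] [:: y; z; x]
| KKnuth_idem x : kknuth_rule [:: x] [:: x; x]
| KKnuth_braid x y : kknuth_rule [:: x; y; x] [:: y; x; y].

Definition kknuth_move (w w' : word) : Prop :=
  exists u v a b : word,
    [/\ w = u ++ a ++ v, w' = u ++ b ++ v & kknuth_rule a b \/ kknuth_rule b a].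

Definition kknuth_equiv (w w' : word) : Prop :=
  exists (r : nat) (ws : nat -> word),
    [/\ ws 0 = w, ws r = w' & forall i, i < r -> kknuth_move (ws i) (ws i.+1)].

Definition kknuth_equiv_le (k : nat) (w w' : word) : Prop :=
  exists (r : nat) (ws : nat -> word),
    [/\ ws 0 = w, ws r = w',
        forall i, i < r -> kknuth_move (ws i) (ws i.+1)
      & forall i, i <= r -> size (ws i) <= k].

(* A filling is the list of its rows, top row first. Rows and columns are
   numbered from 0: cell (i, j) here is the box (i.+1, j.+1) of the diagram. *)
Definition filling := seq (seq nat).

Definition in_diagram (T : filling) (i j : nat) : bool :=
  j < size (nth [::] T i).

(* Only meaningful when in_diagram T i j; the value is 0 elsewhere. *)
Definition entry (T : filling) (i j : nat) : nat := nth 0 (nth [::] T i) j.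

(* Empty rows are excluded so that each tableau has a single encoding; the
   empty tableau is [::]. *)
Definition straight_shape (T : filling) : Prop :=
  [::] \notin T /\
  forall i j i' j', in_diagram T i j -> i' <= i -> j' <= j ->
    in_diagram T i' j'.

Definition increasing_tableau (T : filling) : Prop :=
  [/\ straight_shape T,
      forall i j, in_diagram T i j -> 0 < entry T i j,
      forall i j j', in_diagram T i j -> in_diagram T i j' -> j < j' ->
        entry T i j < entry T i j'
    & forall i i' j, in_diagram T i j -> in_diagram T i' j -> i < i' ->
        entry T i j < entry T i' j].

Definition tableau_on (n : nat) (T : filling) : Prop :=
  forall i j, in_diagram T i j -> 1 <= entry T i j <= n.

Definition row_word (T : filling) : word := flatten (rev T).

Definition tableau_equiv (T T' : filling) : Prop :=
  kknuth_equiv (row_word T) (row_word T').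

(* Main.v *)
(** Insert a letter into a strictly increasing row by bumping the least strictly
    larger entry, leaving the row unchanged if the letter already occurs in it.
    The required moves never lengthen the word. Iterating this rule over the
    rows preserves strict increase of rows and of the first column (the other
    columns are not controlled, unlike in Hecke insertion), so every word [u]
    on [[n]] acquires a representative [Q u] of length at most
    [L = n (n + 1) / 2], and [Q u x] is connected to [Q (u x)] through words of
    length at most [L + 1]. As the moves are invariant under reversal, there is
    a mirror representative [Q' v] that absorbs letters on its left. Transferring
    letters one by one across the product [Q u Q' v] connects it to [Q (u v)]
    within length [2 L + 1]; hence a move [u a v -> u b v] connects
    [Q (u a v)], [Q u a Q' v], [Q u b Q' v] and [Q (u b v)] within length
    [2 L + 3 <= N]. *)
Require Import Defs.
From mathcomp Require Import all_boot zify.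

(** * Bounded K-Knuth equivalence *)

Lemma kknuth_move_sym w w' : kknuth_move w w' -> kknuth_move w' w.
Proof.
move=> [u [v [a [b [-> -> ab]]]]]; exists u, v, b, a; split=> //.
by case: ab; [right | left].
Qed.

Lemma kknuth_move_cat p s w w' :
  kknuth_move w w' -> kknuth_move (p ++ w ++ s) (p ++ w' ++ s).
Proof.
move=> [u [v [a [b [-> -> ab]]]]]; exists (p ++ u), (v ++ s), a, b.
by split=> //; rewrite -!catA.
Qed.

(** Reversal interchanges the two Knuth rules, with their sides swapped, and maps the idempotent and
    braid rules to themselves. *)
Lemma kknuth_rule_rev a b : kknuth_rule a b ->
  kknuth_rule (rev a) (rev b) \/ kknuth_rule (rev b) (rev a).
Proof.
case=> [x y z xy yz|x y z xy yz|x|x y]; rewrite /rev /=.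
- by right; constructor.
- by right; constructor.
- by left; constructor.
- by left; constructor.
Qed.

Lemma kknuth_move_rev w w' : kknuth_move w w' -> kknuth_move (rev w) (rev w').
Proof.
move=> [u [v [a [b [-> -> ab]]]]]; exists (rev v), (rev u), (rev a), (rev b).
rewrite !rev_cat -!catA; split=> //.
by case: ab => /kknuth_rule_rev[]; auto.
Qed.

Lemma size_kknuth_rule a b : kknuth_rule a b -> size a <= 3 /\ size b <= 3.
Proof. by case. Qed.

Lemma mem_kknuth_rule a b : kknuth_rule a b -> a =i b.
Proof.
by case=> [x y z _ _|x y z _ _|x|x y] c; rewrite !inE;
   do ![case: (c == _) => //=].
Qed.

Lemma mem_kknuth_move w w' : kknuth_move w w' -> w =i w'.
Proof.
move=> [u [v [a [b [-> -> ab]]]]] c; rewrite !mem_cat.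
by case: ab => /mem_kknuth_rule ->.
Qed.

Lemma kknuth_le_refl k w : size w <= k -> kknuth_equiv_le k w w.
Proof. by move=> wk; exists 0, (fun=> w). Qed.

Lemma kknuth_le_move k w w' : size w <= k -> size w' <= k ->
  kknuth_move w w' -> kknuth_equiv_le k w w'.
Proof.
move=> wk wk' ww'; exists 1, (fun i => if i is 0 then w else w').
by split=> // [[]|[]].
Qed.

Lemma kknuth_le_sym k w w' : kknuth_equiv_le k w w' -> kknuth_equiv_le k w' w.
Proof.
move=> [r [ws [<- <- mv sz]]]; exists r, (fun i => ws (r - i)).
split; rewrite ?subn0 ?subnn // => i ir; last by apply: sz; lia.
rewrite (_ : r - i = (r - i.+1).+1); last lia.
by apply/kknuth_move_sym/mv; lia.
Qed.

Lemma kknuth_le_trans k w2 w1 w3 :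
  kknuth_equiv_le k w1 w2 -> kknuth_equiv_le k w2 w3 -> kknuth_equiv_le k w1 w3.
Proof.
move=> [r [ws [<- wsr mv sz]]] [r' [ws' [ws0 <- mv' sz']]].
exists (r + r'), (fun i => if i < r then ws i else ws' (i - r)); split.
- by case: r wsr {mv sz} => [->|r _] //=; rewrite ws0.
- by rewrite ifF; [rewrite addKn | lia].
- move=> i irr; case: (ltnP i r) => ir.
    case: ltnP => ir'; first exact: mv.
    have ri : i.+1 = r by lia.
    by rewrite ri subnn ws0 -wsr -ri; apply: mv.
  rewrite ifF; last lia.
  by rewrite subSn //; apply: mv'; lia.
- by move=> i irr; case: ltnP => ir; [apply: sz | apply: sz']; lia.
Qed.

Lemma kknuth_le_weaken k k' w w' :
  k <= k' -> kknuth_equiv_le k w w' -> kknuth_equiv_le k' w w'.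
Proof.
move=> kk' [r [ws [? ? ? sz]]]; exists r, ws; split=> // i ir.
exact: leq_trans (sz i ir) kk'.
Qed.

Lemma kknuth_le_cat p s k w w' : kknuth_equiv_le k w w' ->
  kknuth_equiv_le (size p + k + size s) (p ++ w ++ s) (p ++ w' ++ s).
Proof.
move=> [r [ws [<- <- mv sz]]]; exists r, (fun i => p ++ ws i ++ s); split=> //.
  by move=> i ir; apply/kknuth_move_cat/mv.
by move=> i /sz; rewrite !size_cat; lia.
Qed.

Lemma kknuth_le_catl p k w w' : kknuth_equiv_le k w w' ->
  kknuth_equiv_le (size p + k) (p ++ w) (p ++ w').
Proof. by move/(kknuth_le_cat p [::]); rewrite addn0 !cats0. Qed.

Lemma kknuth_le_catr s k w w' : kknuth_equiv_le k w w' ->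
  kknuth_equiv_le (k + size s) (w ++ s) (w' ++ s).
Proof. exact: (kknuth_le_cat [::]). Qed.

Lemma kknuth_le_rev k w w' :
  kknuth_equiv_le k w w' -> kknuth_equiv_le k (rev w) (rev w').
Proof.
move=> [r [ws [<- <- mv sz]]]; exists r, (fun i => rev (ws i)); split=> // i ir.
  exact/kknuth_move_rev/mv.
by rewrite size_rev; apply: sz.
Qed.

Lemma kknuth_le_rule k s a b :
  kknuth_rule a b \/ kknuth_rule b a -> size (a ++ s) <= k ->
  size (b ++ s) <= k -> kknuth_equiv_le k (a ++ s) (b ++ s).
Proof.
by move=> ab ak bk; apply: kknuth_le_move => //; exists [::], s, a, b.
Qed.

(** * Row insertion *)

(** The first component is the letter sent to the next row. When [x] already occurs, the row stays
    and its successor in the row, if any, is sent on, as in Hecke insertion. *)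
Fixpoint row_insert (R : seq nat) (x : nat) : option nat * seq nat :=
  if R is a :: R' then
    if x < a then (Some a, x :: R')
    else if x == a then (ohead R', R)
    else let: (o, R'') := row_insert R' x in (o, a :: R'')
  else (None, [:: x]).

(** As the new head [c] is at most the old head, the rows below still start beyond it; as
    [c <= x < y], the bumped [y] can enter them with lower bound [c]. For empty [R] the default [x]
    makes the head condition repeat [c <= x]. *)
Variant row_insert_spec (lo n x : nat) (R : seq nat) :
    option nat * seq nat -> Prop :=
  RowInsertSpec o c R' of lo < c & c <= x & c <= head x R
    & path ltn c R' & all (leq^~ n) (c :: R')
    & (forall y, o = Some y -> x < y <= n) :
    row_insert_spec lo n x R (o, c :: R').

Lemma row_insertP lo n x R : path ltn lo R -> all (leq^~ n) R -> lo < x <= n ->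
  row_insert_spec lo n x R (row_insert R x).
Proof.
elim: R lo => [|a R IH] lo /=; first by move=> _ _ /andP[lox xn]; split=> //=; rewrite xn.
move=> /andP[loa aR] /andP[an Rn] /andP[lox xn].
case: ltngtP => [xa|ax|xa].
- split=> //; first exact: ltnW; last by move=> y [<-]; rewrite xa.
    by case: R aR {IH Rn} => //= b R /andP[ab ->]; rewrite (ltn_trans xa ab).
  by rewrite /= xn.
- case: (IH a) => // [|o c R' ac cx _ cR' cn oy]; first by rewrite ax.
  by split=> //=; [exact: ltnW | rewrite ac | rewrite an].
- split=> //; rewrite ?xa //= ?an // => y.
  case: R aR Rn {IH} => //= b R /andP[ab _] /andP[bn _] [<-].
  by rewrite ab.
Qed.

(** The letter [x] jumps over each entry of [R] in turn, from the right, by the rule yxz = yzx; the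
    entry to the left of the one jumped serves as the middle value. *)
Lemma kknuth_le_move_left a x R : path ltn a R -> x < a ->
  kknuth_equiv_le (size R).+2 (a :: R ++ [:: x]) (a :: x :: R).
Proof.
elim: R a => [|b R IH] a /=; first by move=> *; apply: kknuth_le_refl.
move=> /andP[ab bR] xa.
apply: (kknuth_le_trans _ [:: a, b, x & R]).
  exact/(kknuth_le_catl [:: a])/IH/(ltn_trans xa).
apply: (kknuth_le_rule _ R [:: a; b; x] [:: a; x; b]) => //.
by right; constructor.
Qed.

(** The bumped letter comes out on the left of the row, which is where the reading word of the lower
    rows ends. *)
Lemma kknuth_le_row_insert n lo x R :
  path ltn lo R -> all (leq^~ n) R -> lo < x <= n ->
  kknuth_equiv_le (size R).+1 (R ++ [:: x])
    (seq_of_opt (row_insert R x).1 ++ (row_insert R x).2).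
Proof.
elim: R lo => [|a R IH] lo /=; first by move=> *; apply: kknuth_le_refl.
move=> /andP[loa aR] /andP[an Rn] /andP[lox xn].
case: ltngtP => [xa|ax|->].
- exact: kknuth_le_move_left.
- have axn : a < x <= n by rewrite ax.
  have := IH a aR Rn axn.
  case: (row_insertP _ _ _ _ aR Rn axn) => o c R' ac cx _ cR' cn oy /= ins.
  apply: kknuth_le_trans (kknuth_le_catl [:: a] _ _ _ ins) _.
  (* This length is read off the last word of the bounded chain. *)
  have szR : size (seq_of_opt o ++ c :: R') <= (size R).+1.
    by case: ins => r [ws [_ <- _ sz]]; apply: sz.
  (* A bumped [y] satisfies [a < c <= x < y], so it passes to the left of [a] by xzy = zxy with [c]
     as witness. *)
  case: o oy szR {ins} => [y|] oy /= szR; last exact: kknuth_le_refl.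
  have /andP[xy _] := oy y erefl.
  apply: (kknuth_le_rule _ R' [:: a; y; c] [:: y; a; c]) => //=; try lia.
  by left; constructor; lia.
(* Here [x = a]. A lone [a] absorbs its copy; otherwise the copy moves next to [b], and the braid
   aba = bab expels [b] while restoring the row. *)
- case: R aR {IH Rn} => [|b B] /=.
    move=> _; apply: (kknuth_le_rule _ [::] [:: a; a] [:: a]) => //.
    by right; constructor.
  move=> /andP[ab bB].
  apply: (kknuth_le_trans _ [:: a, b, a & B]).
    exact/(kknuth_le_catl [:: a])/kknuth_le_move_left.
  apply: (kknuth_le_rule _ B [:: a; b; a] [:: b; a; b]) => //.
  by left; constructor.
Qed.

(** * Insertion into a stack of rows *)

Fixpoint stack (n lo : nat) (T : filling) : bool :=
  if T is R :: T' then
    [&& R != [::], path ltn lo R, all (leq^~ n) R & stack n (head 0 R) T']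
  else true.

Fixpoint stack_insert (T : filling) (x : nat) : filling :=
  if T is R :: T' then
    let: (o, R') := row_insert R x in
    R' :: (if o is Some y then stack_insert T' y else T')
  else [:: [:: x]].

Lemma stack_weaken n lo lo' T : lo <= lo' -> stack n lo' T -> stack n lo T.
Proof.
case: T => [|[|a R] T] //= ll /andP[/andP[la ->] ->]; rewrite !andbT.
exact: leq_ltn_trans ll la.
Qed.

Lemma stack_insertP n lo T x :
  stack n lo T -> lo < x <= n -> stack n lo (stack_insert T x).
Proof.
elim: T lo x => [|R T IH] lo x /=.
  by move=> _ /andP[-> ->].
move=> /and4P[Rne loR Rn RT] lox.
case: (row_insertP lo n x R loR Rn lox) => o c R' loc cx cR cR' cn oy.
rewrite /= loc cR' /=; apply/andP; split; first exact: cn.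
have cT : stack n c T by apply: stack_weaken RT; case: R Rne cR {loR Rn}.
case: o oy => // y oy; apply: IH => //.
by have /andP[xy ->] := oy y erefl; rewrite (leq_ltn_trans cx xy).
Qed.

Lemma size_bounded_path n lo R :
  path ltn lo R -> all (leq^~ n) R -> lo + size R <= maxn lo n.
Proof.
elim: R lo => [|a R IH] lo /=; first by move=> *; lia.
move=> /andP[loa aR] /andP[an Rn]; have := IH a aR Rn; lia.
Qed.

Lemma row_word_cons R T : row_word (R :: T) = row_word T ++ R.
Proof. by rewrite /row_word rev_cons flatten_rcons. Qed.

(** First entries strictly increase down the stack, so the row lengths are bounded by n - lo, n - lo
    - 1, and so on; the sum is doubled to avoid division. *)
Lemma size_stack_aux n lo T :
  stack n lo T -> 2 * size (row_word T) <= (n - lo) * (n - lo).+1.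
Proof.
elim: T lo => [|[|a R] T IH] lo //=.
move=> /and3P[loaR an aT]; have := IH _ aT.
rewrite row_word_cons size_cat; have := size_bounded_path n lo (a :: R) loaR an.
case/andP: loaR => loa _; case/andP: an => an _ /= sz.
have : (n - a) * (n - a).+1 <= (n - lo).-1 * (n - lo) by apply: leq_mul; lia.
have : (size R).+1 <= n - lo by lia.
by case: (n - lo) => // m; rewrite /= mulSn mulnS; lia.
Qed.

Lemma size_stack n T : stack n 0 T -> 2 * size (row_word T) <= n * n.+1.
Proof. by move/size_stack_aux; rewrite subn0. Qed.

Lemma kknuth_le_stack_insert n lo T x : stack n lo T -> lo < x <= n ->
  kknuth_equiv_le (size (row_word T)).+1
    (row_word T ++ [:: x]) (row_word (stack_insert T x)).
Proof.
elim: T lo x => [|R T IH] lo x /=; first by move=> *; apply: kknuth_le_refl.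
move=> /and4P[Rne loR Rn RT] lox.
have := kknuth_le_row_insert n lo x R loR Rn lox.
case: (row_insertP lo n x R loR Rn lox) => o c R' loc cx cR cR' cn oy /= ins.
rewrite !row_word_cons size_cat -addnS -catA.
apply: kknuth_le_trans (kknuth_le_catl _ _ _ _ ins) _.
have szR : size (seq_of_opt o ++ c :: R') <= (size R).+1.
  by case: ins => r [ws [_ <- _ sz]]; apply: sz.
case: o oy szR {ins} => [y|] oy szR /=; last first.
  by apply: kknuth_le_refl; rewrite size_cat leq_add2l.
(* Regrouped, [y] is appended to the word of the lower rows, ready for the induction hypothesis. *)
rewrite (_ : _ ++ [:: y, c & R'] = (row_word T ++ [:: y]) ++ c :: R'); last first.
  by rewrite -catA.
have cT : stack n c T.
  by apply: stack_weaken RT; case: R Rne cR {loR Rn szR}.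
have cyn : c < y <= n.
  by have /andP[xy ->] := oy y erefl; rewrite (leq_ltn_trans cx xy).
have := kknuth_le_catr (c :: R') _ _ _ (IH c y cT cyn).
by apply: kknuth_le_weaken; rewrite /= in szR *; lia.
Qed.

(** * Bounded representatives of words *)

Definition letters_in (n : nat) : pred word := all (fun x => 0 < x <= n).

Definition insertion_stack (w : word) : filling := foldl stack_insert [::] w.

Definition right_repr (w : word) : word := row_word (insertion_stack w).

Definition left_repr (w : word) : word := rev (right_repr (rev w)).

Lemma stack_insertion n w : letters_in n w -> stack n 0 (insertion_stack w).
Proof.
elim/last_ind: w => //= w x IH.
rewrite /letters_in all_rcons /insertion_stack foldl_rcons => /andP[xn wn].
exact: stack_insertP (IH wn) xn.
Qed.

Section Representatives.

Variables n L : nat.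
Hypothesis L_def : 2 * L = n * n.+1.

Lemma size_right_repr w : letters_in n w -> size (right_repr w) <= L.
Proof. by move/stack_insertion/size_stack; rewrite /right_repr; lia. Qed.

Lemma size_left_repr w : letters_in n w -> size (left_repr w) <= L.
Proof.
by move=> wn; rewrite size_rev; apply: size_right_repr; rewrite /letters_in all_rev.
Qed.

Lemma right_repr_rcons w x : letters_in n (rcons w x) ->
  kknuth_equiv_le L.+1 (right_repr w ++ [:: x]) (right_repr (rcons w x)).
Proof.
rewrite /letters_in all_rcons => /andP[xn wn].
rewrite /right_repr /insertion_stack foldl_rcons.
have := kknuth_le_stack_insert _ _ _ _ (stack_insertion _ _ wn) xn.
by apply: kknuth_le_weaken; rewrite ltnS; apply: size_right_repr.
Qed.

Lemma left_repr_cons x w : letters_in n (x :: w) ->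
  kknuth_equiv_le L.+1 (x :: left_repr w) (left_repr (x :: w)).
Proof.
move=> xwn; have := right_repr_rcons (rev w) x.
rewrite /letters_in all_rcons all_rev => /(_ xwn)/kknuth_le_rev.
by rewrite cats1 rev_rcons /left_repr rev_cons.
Qed.

Lemma right_repr_cat u v : letters_in n (u ++ v) ->
  kknuth_equiv_le (L + size v) (right_repr u ++ v) (right_repr (u ++ v)).
Proof.
elim: v u => [|x v IH] u.
  by rewrite !cats0 => un; apply/kknuth_le_refl/leq_trans/leq_addr/size_right_repr.
rewrite -cat_rcons => uxvn; rewrite /= addnS.
apply: kknuth_le_trans (kknuth_le_weaken _ _ _ _ _ (IH _ uxvn)); last lia.
rewrite -cat_rcons -cats1 -addSn; apply/kknuth_le_catr/right_repr_rcons.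
by move: uxvn; rewrite /letters_in all_cat => /andP[].
Qed.

Lemma left_repr_cat u v : letters_in n (u ++ v) ->
  kknuth_equiv_le (L + size u) (u ++ left_repr v) (left_repr (u ++ v)).
Proof.
move=> uvn; have := right_repr_cat (rev v) (rev u).
rewrite -rev_cat /letters_in all_rev size_rev => /(_ uvn)/kknuth_le_rev.
by rewrite rev_cat revK.
Qed.

(** Each transferred letter is released by the left representative and then absorbed by the right
    one, so only one letter beyond [2 * L] is ever present. *)
Lemma right_repr_left_repr u v : letters_in n (u ++ v) ->
  kknuth_equiv_le (2 * L + 1) (right_repr u ++ left_repr v) (right_repr (u ++ v)).
Proof.
elim: v u => [|x v IH] u.
  rewrite !cats0 => un; apply: kknuth_le_refl.
  by have := size_right_repr u un; lia.
rewrite -cat_rcons => uxvn; apply: kknuth_le_trans (IH _ uxvn).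
move: (uxvn); rewrite /letters_in all_cat => /andP[uxn vn].
move: (uxn); rewrite all_rcons => /andP[xn un].
have szu := size_right_repr u un; have szv := size_left_repr v vn.
have xvn : letters_in n (x :: v) by rewrite /letters_in /= xn.
apply: (kknuth_le_trans _ (right_repr u ++ x :: left_repr v)).
  apply/kknuth_le_sym; have := kknuth_le_catl (right_repr u) _ _ _ (left_repr_cons x v xvn).
  by apply: kknuth_le_weaken; lia.
have := kknuth_le_catr (left_repr v) _ _ _ (right_repr_rcons u x uxn).
by rewrite -catA /=; apply: kknuth_le_weaken; lia.
Qed.

Lemma right_repr_factor u a v : letters_in n (u ++ a ++ v) -> size a <= 3 ->
  kknuth_equiv_le (2 * L + 3) (right_repr (u ++ a ++ v))
    (right_repr u ++ a ++ left_repr v).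
Proof.
move=> uavn a3; move: (uavn); rewrite /letters_in all_cat => /andP[un avn].
apply: (kknuth_le_trans _ (right_repr u ++ left_repr (a ++ v))).
  apply/kknuth_le_sym; have := right_repr_left_repr _ _ uavn.
  by apply: kknuth_le_weaken; lia.
apply/kknuth_le_sym; have := kknuth_le_catl (right_repr u) _ _ _ (left_repr_cat _ _ avn).
by apply: kknuth_le_weaken; have := size_right_repr u un; lia.
Qed.

Lemma right_repr_move w w' : letters_in n w -> kknuth_move w w' ->
  kknuth_equiv_le (2 * L + 3) (right_repr w) (right_repr w').
Proof.
move=> wn ww'.
have wn' : letters_in n w' by rewrite /letters_in -(eq_all_r (mem_kknuth_move _ _ ww')).
case: ww' wn wn' => u [v [a [b [-> -> ab]]]] wn wn'.
have [a3 b3] : size a <= 3 /\ size b <= 3 by case: ab => /size_kknuth_rule[].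
apply: kknuth_le_trans (right_repr_factor _ _ _ wn a3) _.
apply: kknuth_le_trans (kknuth_le_sym _ _ _ (right_repr_factor _ _ _ wn' b3)).
move: wn; rewrite /letters_in !all_cat => /and3P[un _ vn].
have szu := size_right_repr u un; have szv := size_left_repr v vn.
apply: kknuth_le_move; last by exists (right_repr u), (left_repr v), a, b.
  by rewrite !size_cat; lia.
by rewrite !size_cat; lia.
Qed.

Lemma right_repr_equiv w w' : letters_in n w -> kknuth_equiv w w' ->
  kknuth_equiv_le (2 * L + 3) (right_repr w) (right_repr w').
Proof.
move=> wn [r [ws [ws0 <- mv]]].
(* The induction carries membership in the alphabet along, since each move is bounded only for words
   on [n]. *)
suff [] : kknuth_equiv_le (2 * L + 3) (right_repr w) (right_repr (ws r)) /\
  letters_in n (ws r) by [].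
elim: r mv => [|r IH] mv.
  rewrite ws0; split=> //; apply: kknuth_le_refl.
  by have := size_right_repr w wn; lia.
have [i ir|eqr wrn] := IH; first by apply: mv; lia.
have mvr := mv r (leqnn _); split; last first.
  by rewrite /letters_in -(eq_all_r (mem_kknuth_move _ _ mvr)).
exact: kknuth_le_trans eqr (right_repr_move _ _ wrn mvr).
Qed.

(** Absorbing all of [w] into the empty representative costs at most [L + size w]. This links a row
    word to its representative without comparing a tableau with its insertion stack. *)
Lemma right_repr_short w : letters_in n w -> size w <= L ->
  kknuth_equiv_le (2 * L + 3) w (right_repr w).
Proof.
move=> wn wL; have := right_repr_cat [::] w wn.
by apply: kknuth_le_weaken; lia.
Qed.

End Representatives.

(** * Increasing tableaux *)

Lemma tableau_stack n lo T :
  [::] \notin T ->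
  (forall i j j', in_diagram T i j -> in_diagram T i j' -> j < j' ->
     entry T i j < entry T i j') ->
  (forall i i' j, in_diagram T i j -> in_diagram T i' j -> i < i' ->
     entry T i j < entry T i' j) ->
  (forall i, in_diagram T i 0 -> lo < entry T i 0) ->
  (forall i j, in_diagram T i j -> entry T i j <= n) ->
  stack n lo T.
Proof.
elim: T lo => [|[|a R] T IH] lo //=; rewrite inE //= => Tne rows cols los ns.
have -> : lo < a := los 0 isT.
have -> /= : path ltn a R.
  apply/(pathP 0) => i iR; rewrite -[nth 0 (a :: R) i]/(entry ((a :: R) :: T) 0 i).
  by apply: (rows 0 i i.+1) => //; apply: ltnW.
have -> : a <= n := ns 0 0 isT.
have -> /= : all (leq^~ n) R by apply/(all_nthP 0) => i iR; apply: (ns 0 i.+1).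
apply: IH => // [i j j'|i i' j|i|i j].
- exact: rows i.+1 j j'.
- exact: cols i.+1 i'.+1 j.
- by move=> iT; apply: (cols 0 i.+1 0).
- exact: ns i.+1 j.
Qed.

(** The stack property serves to bound the length of the row word by n(n+1)/2. *)
Lemma tableau_row_word n T : increasing_tableau T -> tableau_on n T ->
  stack n 0 T /\ letters_in n (row_word T).
Proof.
move=> [[Tne _] pos rows cols] Tn; split.
  by apply: tableau_stack => // [i /pos|i j /Tn/andP[]].
apply/allP => x /flattenP[R]; rewrite mem_rev => /(nthP [::])[i _ <-].
by move=> /(nthP 0)[j jR <-]; apply: Tn.
Qed.

Theorem theorem4p2 (n : nat) (T1 T2 : filling)
  (n_gt0 : 0 < n)
  (T1_incr : increasing_tableau T1) (T1_on : tableau_on n T1)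
  (T2_incr : increasing_tableau T2) (T2_on : tableau_on n T2)
  (T1_equiv_T2 : tableau_equiv T1 T2) :
  kknuth_equiv_le (n * (n + 1) * (n + 2) %/ 3 + 3) (row_word T1) (row_word T2).
Proof.
have [L L_def] : exists L, 2 * L = n * n.+1.
  by exists 'C(n.+1, 2); rewrite bin2 mul2n halfK oddM /=; case: odd; lia.
have [/size_stack sz1 T1n] := tableau_row_word _ _ T1_incr T1_on.
have [/size_stack sz2 T2n] := tableau_row_word _ _ T2_incr T2_on.
apply: (kknuth_le_weaken (2 * L + 3)).
  (* After clearing the division this is n(n+1) * 3 <= n(n+1)(n+2), which holds as n >= 1. *)
  by rewrite leq_add2r leq_divRL // L_def -addn1; apply: leq_mul; lia.
have short1 := right_repr_short _ _ L_def _ T1n.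
have short2 := right_repr_short _ _ L_def _ T2n.
apply: kknuth_le_trans (short1 _) _; first lia.
apply: kknuth_le_trans (kknuth_le_sym _ _ _ (short2 _)); last lia.
exact: right_repr_equiv T1n T1_equiv_T2.
Qed.
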